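(* Consider the or-constrained program (MPOC) and its nonsmooth reformulation $$\text{(MPOC}(\varphi_{\min})\text{)}\qquad \min_x f(x)\ \text{ s.t. }\ g_i(x)\le 0\ (i\in\mathcal M),\quad h_j(x)=0\ (j\in\mathcal P),\quad \varphi_{\min}(G_l(x),H_l(x))\le 0\ (l\in\mathcal Q),$$ where $\varphi_{\min}(a,b):=\min\{a,b\}$. Then: 1. A feasible point $\bar x\in\mathbb R^n$ of (MPOC) is W-stationary if and only if it is a KKT point of (MPOC$(\varphi_{\min})$) with respect to Clarke's subdifferential. 2. A feasible point $\bar x\in\mathbb R^n$ of (MPOC) is M-stationary if and only if it is a KKT point of (MPOC$(\varphi_{\min})$) with respect to Mordukhovich's subdifferential.
   Context: Let $n,m,p,q$ be positive integers, $\mathcal M:=\{1,\dots,m\}$, $\mathcal P:=\{1,\dots,p\}$, $\mathcal Q:=\{1,\dots,q\}$, and let $f,g_i,h_j,G_l,H_l\colon\mathbb R^n\to\mathbb R$ be continuously differentiable for all $i\in\mathcal M$, $j\in\mathcal P$, $l\in\mathcal Q$. The program (MPOC) is: minimize $f(x)$ subject to $g_i(x)\le 0$ ($i\in\mathcal M$), $h_j(x)=0$ ($j\in\mathcal P$), and ($G_l(x)\le 0$ or $H_l(x)\le 0$) for all $l\in\mathcal Q$. Its feasible set $X$ coincides with that of (MPOC$(\varphi_{\min})$). For $\bar x\in X$ put $I^g(\bar x):=\{i\in\mathcal M: g_i(\bar x)=0\}$, $I^{0+}(\bar x):=\{l\in\mathcal Q: G_l(\bar x)=0,\ H_l(\bar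 x)>0\}$, $I^{+0}(\bar x):=\{l\in\mathcal Q: G_l(\bar x)>0,\ H_l(\bar x)=0\}$, $I^{00}(\bar x):=\{l\in\mathcal Q: G_l(\bar x)=0,\ H_l(\bar x)=0\}$. A point $\bar x\in X$ is W-stationary for (MPOC) if there are multipliers $\lambda_i\ge0$ ($i\in I^g(\bar x)$), $\rho_j\in\mathbb R$ ($j\in\mathcal P$), $\mu_l\ge 0$ ($l\in I^{0+}(\bar x)\cup I^{00}(\bar x)$), $\nu_l\ge0$ ($l\in I^{+0}(\bar x)\cup I^{00}(\bar x)$) with $$0=\nabla f(\bar x)+\sum_{i\in I^g(\bar x)}\lambda_i\nabla g_i(\bar x)+\sum_{j\in\mathcal P}\rho_j\nabla h_j(\bar x)+\sum_{l\in I^{0+}(\bar x)\cup I^{00}(\bar x)}\mu_l\nabla G_l(\bar x)+\sum_{l\in I^{+0}(\bar x)\cup I^{00}(\bar x)}\nu_l\nabla H_l(\bar x).$$ It is M-stationary if such multipliers exist which additionally satisfy $\mu_l\nu_l=0$ for all $l\in I^{00}(\bar x)$. Subdifferentials: for a locally Lipschitz $\psi\colon\mathbb R^k\to\mathbb R$, the Fréchet subdifferential at $\bar x$ is $\partial^{\mathrm F}\psi(\bar x):=\{y:\liminf_{x\to\bar x}(\psi(x)-\psi(\bar x)-y\cdot(x-\bar x))/\|x-\bar x\|_2\ge0\}$; the Mordukhovich subdifferential $\partial^{\mathrm M}\psi(\bar x)$ is the set of all limits $y=\lim y_k$ with $y_k\in\partial^{\mathrm F}\psi(x_k)$ and $x_k\to\bar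 x$; the Clarke subdifferential $\partial^{\mathrm C}\psi(\bar x)$ is the closed convex hull of $\partial^{\mathrm M}\psi(\bar x)$. KKT points of (MPOC$(\varphi)$) for locally Lipschitz $\varphi$: let $I^{\varphi}(\bar x):=\{l\in\mathcal Q:\varphi(G_l(\bar x),H_l(\bar x))=0\}$. A feasible point $\bar x$ is a KKT point with respect to Clarke's (resp. Mordukhovich's) subdifferential if there are $\lambda_i\ge 0$ ($i\in I^g(\bar x)$), $\rho_j\in\mathbb R$ ($j\in\mathcal P$), and, for each $l\in I^\varphi(\bar x)$, a scalar $\xi_l\ge0$ and a pair $(\alpha_l,\beta_l)\in\partial^{\mathrm C}\varphi(G_l(\bar x),H_l(\bar x))$ (resp. $\partial^{\mathrm M}\varphi(G_l(\bar x),H_l(\bar x))$) such that $$0=\nabla f(\bar x)+\sum_{i\in I^g(\bar x)}\lambda_i\nabla g_i(\bar x)+\sum_{j\in\mathcal P}\rho_j\nabla h_j(\bar x)+\sum_{l\in I^\varphi(\bar x)}\xi_l\bigl(\alpha_l\nabla G_l(\bar x)+\beta_l\nabla H_l(\bar x)\bigr).$$ *)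

(* Defs.v *)
From HB Require Import structures.
From mathcomp Require Import all_boot all_order all_algebra.
From mathcomp Require Import all_classical all_reals all_analysis.

Set Implicit Arguments.
Unset Strict Implicit.
Unset Printing Implicit Defensive.

Import Order.TTheory GRing.Theory Num.Theory.
Import numFieldNormedType.Exports.

Local Open Scope classical_set_scope.
Local Open Scope ring_scope.

Section Euclidean.
Context {R : realType} {n : nat}.
Implicit Types (f : 'rV[R]_n -> R) (x y : 'rV[R]_n).

Definition dotp x y : R := \sum_i x ord0 i * y ord0 i.

(* The library norm [`|x|] on ['rV_n] is the maximum norm. *)
Definition norm2 x : R := Num.sqrt (dotp x x).

Definition gradient f x : 'rV[R]_n := \row_i 'd f x (delta_mx ord0 i).

Definition continuously_differentiable f :=
  (forall x, differentiable f x) /\ continuous (gradient f).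

End Euclidean.

(* The subdifferentials are only meant for locally Lipschitz [psi]. *)
Section Subdifferentials.
Context {R : realType} {k : nat}.
Implicit Types (psi : 'rV[R]_k -> R) (x y : 'rV[R]_k).

Definition frechet_subdiff psi x : set 'rV[R]_k :=
  [set y | (0%:E <= limf_einf
     (fun z => ((psi z - psi x - dotp y (z - x)) / norm2 (z - x))%:E)
     x^')%E].

Definition mordukhovich_subdiff psi x : set 'rV[R]_k :=
  [set y | exists (x_ y_ : nat -> 'rV[R]_k),
     [/\ forall i, frechet_subdiff psi (x_ i) (y_ i),
         x_ @ \oo --> x & y_ @ \oo --> y]].

Definition closed_convex_hull (A : set 'rV[R]_k) : set 'rV[R]_k :=
  smallest [set C : set 'rV[R]_k | closed C /\ convex_set (M := 'rV[R]_k) C] A.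

Definition clarke_subdiff psi x : set 'rV[R]_k :=
  closed_convex_hull (mordukhovich_subdiff psi x).

End Subdifferentials.

Definition vec2 {R : realType} (a b : R) : 'rV[R]_2 :=
  \row_(i < 2) [:: a; b]`_i.

Definition phi_min {R : realType} (v : 'rV[R]_2) : R :=
  Num.min (v ord0 ord0) (v ord0 ord_max).

(* The multipliers are indexed by all of ['I_m], ['I_p] and ['I_q]; their
   values outside the relevant active index set are unconstrained and unused. *)
Section Program.
Context {R : realType} {n m p q : nat}.
Variables (f : 'rV[R]_n -> R) (g : 'I_m -> 'rV[R]_n -> R)
  (h : 'I_p -> 'rV[R]_n -> R) (G H : 'I_q -> 'rV[R]_n -> R).
Implicit Types (x : 'rV[R]_n) (phi : 'rV[R]_2 -> R).

Definition mpoc_feasible : set 'rV[R]_n :=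
  [set x | [/\ forall i, g i x <= 0, forall j, h j x = 0
             & forall l, G l x <= 0 \/ H l x <= 0]].

Definition Ig x : {set 'I_m} := [set i | g i x == 0]%SET.
Definition I0p x : {set 'I_q} := [set l | (G l x == 0) && (0 < H l x)]%SET.
Definition Ip0 x : {set 'I_q} := [set l | (0 < G l x) && (H l x == 0)]%SET.
Definition I00 x : {set 'I_q} := [set l | (G l x == 0) && (H l x == 0)]%SET.

Definition W_multipliers x (lambda : 'I_m -> R) (rho : 'I_p -> R)
    (mu nu : 'I_q -> R) : Prop :=
  [/\ forall i, i \in Ig x -> 0 <= lambda i,
      forall l, l \in I0p x :|: I00 x -> 0 <= mu l,
      forall l, l \in Ip0 x :|: I00 x -> 0 <= nu l
    & 0 = gradient f x + \sum_(i in Ig x) lambda i *: gradient (g i) x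
          + \sum_j rho j *: gradient (h j) x
          + \sum_(l in I0p x :|: I00 x) mu l *: gradient (G l) x
          + \sum_(l in Ip0 x :|: I00 x) nu l *: gradient (H l) x].

Definition W_stationary x : Prop :=
  mpoc_feasible x /\
  exists (lambda : 'I_m -> R) (rho : 'I_p -> R) (mu nu : 'I_q -> R),
    W_multipliers x lambda rho mu nu.

Definition M_stationary x : Prop :=
  mpoc_feasible x /\
  exists (lambda : 'I_m -> R) (rho : 'I_p -> R) (mu nu : 'I_q -> R),
    W_multipliers x lambda rho mu nu /\
    forall l, l \in I00 x -> mu l * nu l = 0.

Definition mpoc_phi_feasible phi : set 'rV[R]_n :=
  [set x | [/\ forall i, g i x <= 0, forall j, h j x = 0
             & forall l, phi (vec2 (G l x) (H l x)) <= 0]].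

Definition Iphi phi x : {set 'I_q} :=
  [set l | phi (vec2 (G l x) (H l x)) == 0]%SET.

Definition KKT_point
    (subdiff : ('rV[R]_2 -> R) -> 'rV[R]_2 -> set 'rV[R]_2) phi x : Prop :=
  mpoc_phi_feasible phi x /\
  exists (lambda : 'I_m -> R) (rho : 'I_p -> R) (xi alpha beta : 'I_q -> R),
  [/\ forall i, i \in Ig x -> 0 <= lambda i,
      forall l, l \in Iphi phi x -> 0 <= xi l,
      forall l, l \in Iphi phi x ->
        subdiff phi (vec2 (G l x) (H l x)) (vec2 (alpha l) (beta l))
    & 0 = gradient f x + \sum_(i in Ig x) lambda i *: gradient (g i) x
          + \sum_j rho j *: gradient (h j) x
          + \sum_(l in Iphi phi x)
              xi l *: (alpha l *: gradient (G l) x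
                       + beta l *: gradient (H l) x)].

End Program.

(* Main.v *)
Require Import Defs.
From mathcomp Require Import all_boot all_order all_algebra.
From mathcomp Require Import all_classical all_reals all_analysis.
From mathcomp Require Import lra.

Set Implicit Arguments.
Unset Strict Implicit.
Unset Printing Implicit Defensive.

Import Order.TTheory GRing.Theory Num.Theory.
Import numFieldNormedType.Exports.

Local Open Scope classical_set_scope.
Local Open Scope ring_scope.

(** Both equivalences come from one computation: the subdifferentials of the
    minimum of two coordinates. Write e_0, e_1 for the unit vectors of the
    plane and call a coordinate of v active when it attains the minimum.

    Off the diagonal the minimum is locally a single coordinate, so the Frechet
    subdifferential is the corresponding singleton. On the diagonal it is empty:
    along both e_0 - e_1 and its opposite the minimum decreases at rate 1,
    which no linear minorant allows (frechet_phi_min_lt, frechet_phi_min_tie).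
    Taking limits, the Mordukhovich subdifferential consists of exactly the e_i
    with i active: these pairs form a closed graph, and any active e_i is a
    Frechet subgradient at points obtained by slightly lowering coordinate i
    (mordukhovich_phi_min). Its convex hull is the face of the unit simplex
    spanned by the active e_i (clarke_phi_min).

    A KKT condition sees a constraint l only through the products
    mu_l = xi_l alpha_l and nu_l = xi_l beta_l, that is through the cone
    generated by the subdifferential. For Clarke this cone is the set of
    nonnegative pairs supported on the active coordinates; for Mordukhovich the
    pair is moreover complementary, mu_l nu_l = 0 (clarke_cone_phi_min,
    mordukhovich_cone_phi_min). At a constraint whose minimum is zero, G_l is
    active exactly when G_l = 0, and likewise for H_l, so these are the sign,
    support and complementarity conditions of W- and M-stationarity; it remains
    to match the index sets and to split the sum (multipliers_phi_minP). *)

(** * Dot product and Euclidean norm *)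

Lemma dotpZr (R : realType) n (y u : 'rV[R]_n) t :
  dotp y (t *: u) = t * dotp y u.
Proof.
by rewrite /dotp mulr_sumr; apply: eq_bigr => i _; rewrite mxE mulrCA.
Qed.

Lemma dotpBl (R : realType) n (x y u : 'rV[R]_n) :
  dotp (x - y) u = dotp x u - dotp y u.
Proof.
by rewrite /dotp -sumrB; apply: eq_bigr => i _; rewrite !mxE mulrBl.
Qed.

Lemma dotp_deltar (R : realType) n (y : 'rV[R]_n) i :
  dotp y (delta_mx ord0 i) = y ord0 i.
Proof.
rewrite /dotp (bigD1 i) //= mxE !eqxx mulr1 big1 ?addr0 // => j ji.
by rewrite mxE (negbTE ji) andbF mulr0.
Qed.

Lemma dotpC (R : realType) n (x y : 'rV[R]_n) : dotp x y = dotp y x.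
Proof. by apply: eq_bigr => i _; rewrite mulrC. Qed.

Lemma dotp_ge0 (R : realType) n (u : 'rV[R]_n) : 0 <= dotp u u.
Proof. by apply: sumr_ge0 => i _; rewrite -expr2 sqr_ge0. Qed.

Lemma dotp_eq0 (R : realType) n (u : 'rV[R]_n) : dotp u u = 0 -> u = 0.
Proof.
move=> /eqP; rewrite psumr_eq0 => [|i _]; last by rewrite -expr2 sqr_ge0.
move=> /allP u0; apply/rowP => i.
by have := u0 i (mem_index_enum _); rewrite /= mulf_eq0 orbb mxE => /eqP.
Qed.

Lemma norm2_gt0 (R : realType) n (u : 'rV[R]_n) : u != 0 -> 0 < norm2 u.
Proof.
move=> u0; rewrite sqrtr_gt0 lt_neqAle dotp_ge0 andbT eq_sym.
by apply: contra u0 => /eqP/dotp_eq0 ->.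
Qed.

Lemma norm2Z (R : realType) n (u : 'rV[R]_n) t :
  0 <= t -> norm2 (t *: u) = t * norm2 u.
Proof.
move=> t0; rewrite /norm2 dotpZr dotpC dotpZr mulrA -expr2.
by rewrite sqrtrM ?sqr_ge0 // sqrtr_sqr ger0_norm.
Qed.

(** * Frechet subgradients of general functions *)

Lemma limf_einf_ge0 (T : choiceType) (X : filteredType T) (R : realType)
    (u : X -> R) (F : set_system X) : Filter F ->
  (0%:E <= limf_einf (fun z => (u z)%:E) F)%E ->
  forall e, 0 < e -> \forall z \near F, - e <= u z.
Proof.
move=> FF; rewrite limf_einfE => h e e0.
have : ((- e)%:E <
    ereal_sup [set ereal_inf ((fun z => (u z)%:E) @` V) | V in F])%E.
  by apply: lt_le_trans h; rewrite lte_fin oppr_lt0.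
move=> /ereal_sup_gt[_ [V FV <-] /ltW eV].
apply: filterS FV => z Vz; rewrite -lee_fin (le_trans eV) //.
by apply: ereal_inf_lbound; exists z.
Qed.

Lemma limf_einf_near0 (T : choiceType) (X : filteredType T) (R : realType)
    (u : X -> R) (F : set_system X) :
  (\forall z \near F, u z = 0) ->
  (0%:E <= limf_einf (fun z => (u z)%:E) F)%E.
Proof.
move=> u0; rewrite limf_einfE.
set V := [set z | u z = 0].
apply: (@le_trans _ _ (ereal_inf ((fun z => (u z)%:E) @` V))).
  by apply: le_ereal_inf_tmp => _ [z Vz <-]; rewrite lee_fin Vz.
by apply: ereal_sup_ubound; exists V.
Qed.

Lemma cvg_ray (R : realType) k (x d : 'rV[R]_k) :
  x + t *: d @[t --> (0 : R)^'+] --> x.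
Proof.
rewrite -[X in _ --> X]addr0 -[X in _ + X](scale0r d).
apply: cvgD; first exact: cvg_cst.
apply: cvgZr_tmp; exact: cvg_at_right_filter.
Qed.

(** Along a ray on which psi is affine the step length cancels from the
    difference quotient, which is the constant (c - y.d) / |d|; a constant whose
    lower limit is nonnegative is itself nonnegative. *)
Lemma frechet_subdiff_dir_le (R : realType) k (psi : 'rV[R]_k -> R)
    (x y d : 'rV[R]_k) c :
  frechet_subdiff psi x y ->
  (\forall t \near (0 : R)^'+, psi (x + t *: d) = psi x + t * c) ->
  d != 0 -> dotp y d <= c.
Proof.
move=> yF psid d0; have nd := norm2_gt0 d0.
apply/ler_addgt0Pl => e e0.
have e'0 : 0 < e / norm2 d by rewrite divr_gt0.
have near_e := limf_einf_ge0 (dnbhs_filter x) yF e'0.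
near (0 : R)^'+ => t.
have t0 : 0 < t by near: t; exact: nbhs_right_gt.
have psit : psi (x + t *: d) = psi x + t * c by near: t.
have ht : x + t *: d != x ->
    - (e / norm2 d) <= (psi (x + t *: d) - psi x - dotp y (x + t *: d - x))
                       / norm2 (x + t *: d - x).
  by near: t; exact: (@cvg_ray R k x d _ near_e).
have tn : x + t *: d - x = t *: d by rewrite addrAC subrr add0r.
have := ht; rewrite tn dotpZr (norm2Z _ (ltW t0)) psit.
rewrite [psi x + _]addrC addrK -mulrBr.
rewrite invfM mulrACA divff ?gt_eqF // mul1r -mulNr ler_pM2r ?invr_gt0 //.
rewrite -subr_eq0 tn scaler_eq0 (gt_eqF t0) (negbTE d0) => /(_ isT).
by rewrite lerBrDl lerBlDl; lra.
Unshelve. all: by end_near. Qed.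

(** Uniqueness: a subgradient y tested in the direction y - s gives
    |y - s|^2 <= 0. *)
Lemma frechet_subdiff_affine (R : realType) k (psi : 'rV[R]_k -> R) x s :
  (\forall z \near x, psi z = psi x + dotp s (z - x)) ->
  frechet_subdiff psi x = [set s].
Proof.
move=> affx; apply/seteqP; split => [y yF|_ ->] /=; last first.
  apply: limf_einf_near0.
  apply: nbhs_dnbhs; near=> z.
  have -> : psi z = psi x + dotp s (z - x) by near: z.
  by rewrite [psi x + _]addrC addrK subrr mul0r.
have [//|ys] := eqVneq y s.
have path := @cvg_ray R k x (y - s).
have := frechet_subdiff_dir_le (d := y - s) (c := dotp s (y - s)) yF.
rewrite subr_eq0 -subr_le0 -dotpBl => /(_ _ ys) ysle.
apply/eqP; rewrite -subr_eq0; apply/eqP/dotp_eq0/eqP.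
rewrite eq_le dotp_ge0 andbT; apply: ysle.
near=> t.
have -> : psi (x + t *: (y - s)) = psi x + dotp s (x + t *: (y - s) - x).
  by near: t; exact: (path _ affx).
by rewrite [x + _]addrC addrK dotpZr.
Unshelve. all: by end_near. Qed.

(** * Subdifferentials of the minimum of two coordinates *)

Lemma ord2P (i : 'I_2) : i = ord0 \/ i = ord_max.
Proof. by case: i => -[|[|//]] ?; [left|right]; apply/val_inj. Qed.

Lemma ord2_neq (i j : 'I_2) :
  i != j -> i = ord0 /\ j = ord_max \/ i = ord_max /\ j = ord0.
Proof.
by case: (ord2P i) => ->; case: (ord2P j) => -> //; [left|right].
Qed.

Lemma phi_min_le (R : realType) (v : 'rV[R]_2) i : phi_min v <= v ord0 i.
Proof. by case: (ord2P i) => ->; rewrite ge_min lexx ?orbT. Qed.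

Lemma phi_minE (R : realType) (v : 'rV[R]_2) i j :
  i != j -> v ord0 i <= v ord0 j -> phi_min v = v ord0 i.
Proof.
by case/ord2_neq => -[-> ->]; [apply: min_l|apply: min_r].
Qed.

Lemma phi_min_attained (R : realType) (v : 'rV[R]_2) :
  v ord0 ord0 = phi_min v \/ v ord0 ord_max = phi_min v.
Proof.
by rewrite /phi_min minEle; case: ifP => _; [left|right].
Qed.

Lemma frechet_phi_min_lt (R : realType) (v : 'rV[R]_2) i j :
  v ord0 i < v ord0 j -> frechet_subdiff phi_min v = [set delta_mx ord0 i].
Proof.
move=> vij; have ij : i != j by apply: contraTneq vij => ->; rewrite ltxx.
apply: frechet_subdiff_affine.
have cij : {for v, continuous (fun z : 'rV[R]_2 => z ord0 j - z ord0 i)}.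
  by apply: cvgB; [exact: nbhs_filter|exact: coord_continuous..].
near=> z; rewrite dotpC dotp_deltar !mxE (phi_minE ij (ltW vij)).
rewrite addrCA subrr addr0.
apply: (phi_minE ij); rewrite -subr_ge0 ltW //; near: z.
by apply: (cvgr_gt (v ord0 j - v ord0 i)) => //; rewrite subr_gt0.
Unshelve. all: by end_near. Qed.

(** Moving away from the diagonal along e_i - e_j lowers the minimum at unit
    rate; doing so for both orders of i and j forces both y_0 - y_1 and
    y_1 - y_0 to be at most -1. *)
Lemma frechet_phi_min_tie (R : realType) (v y : 'rV[R]_2) :
  v ord0 ord0 = v ord0 ord_max -> ~ frechet_subdiff phi_min v y.
Proof.
move=> tie yF.
have ray (i j : 'I_2) : i != j ->
    dotp y (delta_mx ord0 i - delta_mx ord0 j) <= -1.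
  move=> ij; apply: (frechet_subdiff_dir_le yF).
    near=> t; have t0 : 0 < t by near: t; exact: nbhs_right_gt.
    have vij : v ord0 i = v ord0 j.
      by case/ord2_neq: ij => -[-> ->].
    have ji : j != i by rewrite eq_sym.
    rewrite (phi_minE (v := v) ij) ?vij // (phi_minE ji);
      rewrite !mxE !eqxx ?(negbTE ij) (negbTE ji) /= ?vij; lra.
  apply/eqP => /rowP/(_ i); rewrite !mxE !eqxx (negbTE ij) subr0 => /eqP.
  by rewrite oner_eq0.
have := ray ord_max ord0 isT; have := ray ord0 ord_max isT.
by rewrite ![dotp y _]dotpC !dotpBl; lra.
Unshelve. all: by end_near. Qed.

Lemma frechet_phi_min_active (R : realType) (v y : 'rV[R]_2) :
  frechet_subdiff phi_min v y ->
  exists2 i, v ord0 i = phi_min v & y = delta_mx ord0 i.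
Proof.
have [v01|v10|/frechet_phi_min_tie v01 /v01 //] :=
  ltgtP (v ord0 ord0) (v ord0 ord_max).
- rewrite (frechet_phi_min_lt v01) => ->; exists ord0 => //.
  by rewrite (phi_minE (i := ord0) (j := ord_max)) ?ltW.
- rewrite (frechet_phi_min_lt v10) => ->; exists ord_max => //.
  by rewrite (phi_minE (i := ord_max) (j := ord0)) ?ltW.
Qed.

Lemma continuous_phi_min (R : realType) : continuous (@phi_min R).
Proof.
move=> v; apply: (@continuous_min R _ (fun w : 'rV[R]_2 => w ord0 ord0)
  (fun w : 'rV[R]_2 => w ord0 ord_max)); exact: coord_continuous.
Qed.

(** Being active is an equation between continuous functions of the point; this
    makes the candidate subdifferential stable under limits. *)
Lemma closed_active_graph (R : realType) (i : 'I_2) :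
  closed [set w : 'rV[R]_2 * 'rV[R]_2 |
    w.1 ord0 i = phi_min w.1 /\ w.2 = delta_mx ord0 i].
Proof.
have -> : [set w : 'rV[R]_2 * 'rV[R]_2 |
    w.1 ord0 i = phi_min w.1 /\ w.2 = delta_mx ord0 i] =
  (fun w : 'rV[R]_2 * 'rV[R]_2 => w.1) @^-1`
    ((fun v : 'rV[R]_2 => v ord0 i - phi_min v) @^-1` [set r | r = 0])
  `&` (fun w : 'rV[R]_2 * 'rV[R]_2 => w.2) @^-1` [set delta_mx ord0 i].
  apply/seteqP; split => w /= [e1 e2]; split => //; first by rewrite e1 subrr.
  by apply/eqP; rewrite -subr_eq0 e1.
apply: closedI; apply: preimage_closed.
- by move=> w _; exact: cvg_fst.
- apply: preimage_closed; last exact: closed_eq.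
  move=> v _; apply: cvgB; [exact: nbhs_filter|exact: coord_continuous|].
  exact: continuous_phi_min.
- by move=> w _; exact: cvg_snd.
- apply: accessible_closed_set1; apply: hausdorff_accessible.
  exact: norm_hausdorff.
Qed.

(** Activity, not strict minimality, is what survives in the limit, so at a tie
    both unit vectors appear although no Frechet subgradient exists there. *)
Lemma mordukhovich_phi_min (R : realType) (v y : 'rV[R]_2) :
  mordukhovich_subdiff phi_min v y <->
  exists2 i, v ord0 i = phi_min v & y = delta_mx ord0 i.
Proof.
split => [[x_ [y_ [yF xv yy]]]|[i vi ->]].
  pose A i := [set w : 'rV[R]_2 * 'rV[R]_2 |
    w.1 ord0 i = phi_min w.1 /\ w.2 = delta_mx ord0 i].
  suff [[]|[]] : (A ord0 `|` A ord_max) (v, y).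
  - by exists ord0.
  - by exists ord_max.
  apply: (@closed_cvg _ _ \oo _ (fun k => (x_ k, y_ k)) (A ord0 `|` A ord_max)).
  - by apply: closedU; exact: closed_active_graph.
  - near=> k; have [i xi yi] := frechet_phi_min_active (yF k).
    by move: xi yi; case: (ord2P i) => ->; [left|right].
  - exact: (cvg_pair xv yy).
(* Lowering an active coordinate makes it the strict minimum, whatever the
   other coordinate is. *)
exists (fun k => v - harmonic k *: delta_mx ord0 i), (fun=> delta_mx ord0 i).
split; last exact: cvg_cst.
- move=> k.
  have [j ij] : exists j, i != j.
    by case: (eqVneq i ord0) => [->|i0]; [exists ord_max|exists ord0].
  rewrite (frechet_phi_min_lt (i := i) (j := j)) // !mxE !eqxx.
  rewrite eq_sym (negbTE ij) /= mulr1 mulr0 subr0.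
  by rewrite vi (lt_le_trans _ (phi_min_le v j)) // gtrBl invr_gt0.
- rewrite -[X in _ --> X]subr0 -[X in _ - X](scale0r (delta_mx ord0 i : 'rV[R]_2)).
  apply: cvgB; first exact: cvg_cst.
  by apply: cvgZr_tmp; exact: cvg_harmonic.
Unshelve. all: by end_near. Qed.

(** A point of the face of the simplex is a convex combination of e_0 and e_1;
    when a coordinate is inactive its weight vanishes and the combination
    reduces to a single unit vector, which is already a limiting subgradient. *)
Lemma clarke_phi_min (R : realType) (v y : 'rV[R]_2) :
  clarke_subdiff phi_min v y <->
  [/\ y ord0 ord0 + y ord0 ord_max = 1, forall i, 0 <= y ord0 i
    & forall i, v ord0 i != phi_min v -> y ord0 i = 0].
Proof.
split.
  pose D := [set z : 'rV[R]_2 |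
   [/\ z ord0 ord0 + z ord0 ord_max = 1, forall i, 0 <= z ord0 i
     & forall i, v ord0 i != phi_min v -> z ord0 i = 0]].
  have DC : closed D /\ convex_set (M := 'rV[R]_2) D.
    split.
      have -> : D = [set z | z ord0 ord0 + z ord0 ord_max = 1]
          `&` (\bigcap_i [set z | 0 <= z ord0 i])
          `&` (\bigcap_(i in [set i | v ord0 i != phi_min v])
                 [set z | z ord0 i = 0]).
        apply/seteqP; split => [z [z1 z0 zv]|z [[z1 z0] zv]].
          by split; [split => // i _; exact: z0|move=> i; exact: zv].
        by split; [exact: z1|move=> i; exact: z0|exact: zv].
      apply: closedI; [apply: closedI|].
      - apply: (@preimage_closed _ _
          (fun z : 'rV[R]_2 => z ord0 ord0 + z ord0 ord_max)
          [set r | r = 1]); last exact: closed_eq.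
        move=> z _; apply: cvgD; [exact: nbhs_filter|exact: coord_continuous..].
      - apply: closed_bigI => i _.
        apply: (@preimage_closed _ _ (fun z : 'rV[R]_2 => z ord0 i)
          [set r | 0 <= r]); last exact: closed_ge.
        by move=> z _; exact: coord_continuous.
      - apply: closed_bigI => i _.
        apply: (@preimage_closed _ _ (fun z : 'rV[R]_2 => z ord0 i)
          [set r | r = 0]); last exact: closed_eq.
        by move=> z _; exact: coord_continuous.
    move=> a b t; rewrite !inE => -[a1 a0 av] [b1 b0 bv].
    have t0 : 0 <= t%:num by [].
    have t1 : t%:num <= 1 by [].
    split.
    - rewrite !mxE /unstable.onem.
      have -> : a ord0 ord0 = 1 - a ord0 ord_max by rewrite -a1 addrK.
      have -> : b ord0 ord0 = 1 - b ord0 ord_max by rewrite -b1 addrK.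
      lra.
    - by move=> i; rewrite !mxE addr_ge0 // mulr_ge0 // unstable.onem_ge0.
    - by move=> i vi; rewrite !mxE av // bv // !mulr0 addr0.
  apply: (smallest_sub DC).
  move=> _ /mordukhovich_phi_min[i vi ->]; split.
  - by rewrite !mxE; case: (ord2P i) => ->;
      rewrite /= ?addr0 ?add0r.
  - by move=> j; rewrite !mxE ler0n.
  - move=> j vj; rewrite mxE.
    by case: (eqVneq j i) vj => [->|//]; rewrite vi eqxx.
move=> [y1 y0 yv] C [[_ convC] sC].
have e_in i : v ord0 i = phi_min v -> C (delta_mx ord0 i).
  by move=> vi; apply: sC; apply/mordukhovich_phi_min; exists i.
have yE : y = y ord0 ord0 *: delta_mx ord0 ord0
            + y ord0 ord_max *: delta_mx ord0 ord_max.
  apply/rowP => k; rewrite !mxE.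
  by case: (ord2P k) => ->;
    rewrite /= mulr0 mulr1 ?addr0 ?add0r.
have [v0|v0] := eqVneq (v ord0 ord0) (phi_min v); last first.
  rewrite yE; move: y1; rewrite (yv _ v0) add0r => ->.
  rewrite scale0r scale1r add0r; apply: e_in.
  by case: (phi_min_attained v) v0 => // ->; rewrite eqxx.
have [v1|v1] := eqVneq (v ord0 ord_max) (phi_min v); last first.
  rewrite yE; move: y1; rewrite (yv _ v1) addr0 => ->.
  by rewrite scale0r scale1r addr0; apply: e_in.
have t01 : 0 <= y ord0 ord0 <= 1.
  by rewrite y0 -y1 lerDl y0.
have := convC (delta_mx ord0 ord0) (delta_mx ord0 ord_max)
  (Itv01 (y0 ord0) (proj2 (andP t01))).
rewrite !inE => /(_ (e_in _ v0) (e_in _ v1)).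
congr (C _); rewrite [RHS]yE; congr (_ + _ *: _).
by rewrite /= /unstable.onem -y1 addrAC subrr add0r.
Qed.

(** * From subgradients to multipliers *)

(** The cone generated by S. A KKT condition constrains a subgradient
    (alpha, beta) and its multiplier xi only through these products. *)
Definition subgrad_cone (R : realType) (S : set 'rV[R]_2) (a b : R) : Prop :=
  exists xi alpha beta,
    [/\ 0 <= xi, S (vec2 alpha beta), a = xi * alpha & b = xi * beta].

Lemma vec2_0 (R : realType) (a b : R) : vec2 a b ord0 ord0 = a.
Proof. by rewrite mxE. Qed.

Lemma vec2_1 (R : realType) (a b : R) : vec2 a b ord0 ord_max = b.
Proof. by rewrite mxE. Qed.

Lemma phi_min_vec2 (R : realType) (a b : R) : phi_min (vec2 a b) = Num.min a b.
Proof. by rewrite /phi_min vec2_0 vec2_1. Qed.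

Lemma vec2_delta (R : realType) (a b : R) (i : 'I_2) :
  (vec2 a b = delta_mx ord0 i) <->
  a = (i == ord0)%:R /\ b = (i == ord_max)%:R.
Proof.
split=> [e|[-> ->]].
  rewrite -(vec2_0 a b) -[in b = _](vec2_1 a b) e !mxE /=.
  by rewrite ![i == _]eq_sym.
by apply/rowP => j; rewrite !mxE; case: (ord2P i) => ->; case: (ord2P j) => ->.
Qed.

(** A nonzero pair is normalised by its sum a + b to land on the simplex; the
    zero pair needs xi = 0 together with any subgradient, and one exists since some
    coordinate is active. *)
Lemma clarke_cone_phi_min (R : realType) (v : 'rV[R]_2) a b :
  subgrad_cone (clarke_subdiff phi_min v) a b <->
  [/\ 0 <= a, 0 <= b, v ord0 ord0 != phi_min v -> a = 0
    & v ord0 ord_max != phi_min v -> b = 0].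
Proof.
split=> [[xi [al [be [xi0 /clarke_phi_min[_ y0 yv] -> ->]]]]|[a0 b0 av bv]].
  have := y0 ord0; have := y0 ord_max; have := yv ord0; have := yv ord_max.
  rewrite vec2_0 vec2_1 => be_v al_v be0 al0.
  split; [exact: mulr_ge0..|by move=> /al_v ->; rewrite mulr0
         |by move=> /be_v ->; rewrite mulr0].
have [ab0|ab0] := eqVneq (a + b) 0.
  have [-> ->] : a = 0 /\ b = 0 by split; lra.
  have [i vi] : exists i, v ord0 i = phi_min v.
    by case: (phi_min_attained v); [exists ord0|exists ord_max].
  exists 0, (i == ord0)%:R, (i == ord_max)%:R; rewrite !mul0r; split => //.
  apply: sub_gen_smallest; apply/mordukhovich_phi_min; exists i => //.
  exact/vec2_delta.
have abp : 0 < a + b by rewrite lt_neqAle eq_sym ab0 addr_ge0.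
exists (a + b), (a / (a + b)), (b / (a + b)); split.
- exact: ltW.
- apply/clarke_phi_min; split.
  + by rewrite vec2_0 vec2_1 -mulrDl divff.
  + by move=> i; case: (ord2P i) => ->;
      rewrite ?vec2_0 ?vec2_1 divr_ge0 // ltW.
  + by move=> i; case: (ord2P i) => -> => [/av ->|/bv ->];
      rewrite ?vec2_0 ?vec2_1 mul0r.
- by rewrite mulrC divfK.
- by rewrite mulrC divfK.
Qed.

(** The cone is a union of rays along the active axes, whence the
    complementarity a b = 0. *)
Lemma mordukhovich_cone_phi_min (R : realType) (v : 'rV[R]_2) a b :
  subgrad_cone (mordukhovich_subdiff phi_min v) a b <->
  [/\ 0 <= a, 0 <= b, a * b = 0, v ord0 ord0 != phi_min v -> a = 0
    & v ord0 ord_max != phi_min v -> b = 0].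
Proof.
split=> [[xi [al [be [xi0 /mordukhovich_phi_min[i vi /vec2_delta[-> ->]] -> ->]]]]
       |[a0 b0 ab av bv]].
  by case: (ord2P i) vi => -> vi /=; rewrite !mulr1 !mulr0 ?mul0r ?vi ?eqxx.
have cone_e i xi : 0 <= xi -> v ord0 i = phi_min v ->
    subgrad_cone (mordukhovich_subdiff phi_min v)
      (xi * (i == ord0)%:R) (xi * (i == ord_max)%:R).
  move=> xi0 vi; exists xi, (i == ord0)%:R, (i == ord_max)%:R; split => //.
  by apply/mordukhovich_phi_min; exists i => //; exact/vec2_delta.
have cone_a : v ord0 ord0 = phi_min v -> b = 0 ->
    subgrad_cone (mordukhovich_subdiff phi_min v) a b.
  by move=> v0 ->; have := cone_e ord0 a a0 v0; rewrite mulr1 mulr0.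
have cone_b : v ord0 ord_max = phi_min v -> a = 0 ->
    subgrad_cone (mordukhovich_subdiff phi_min v) a b.
  by move=> v1 ->; have := cone_e ord_max b b0 v1; rewrite mulr1 mulr0.
have [v0|/av a_0] := eqVneq (v ord0 ord0) (phi_min v); last first.
  have [v1|/bv b_0] := eqVneq (v ord0 ord_max) (phi_min v); first exact: cone_b.
  by case: (phi_min_attained v) => [/cone_a|/cone_b]; apply.
have [v1|/bv] := eqVneq (v ord0 ord_max) (phi_min v); last exact: cone_a.
by move/eqP: ab; rewrite mulf_eq0 => /orP[] /eqP; [exact: cone_b|exact: cone_a].
Qed.

Lemma phi_min_feasible (R : realType) n m p q (g : 'I_m -> 'rV[R]_n -> R)
    (h : 'I_p -> 'rV[R]_n -> R) (G H : 'I_q -> 'rV[R]_n -> R) x :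
  mpoc_feasible g h G H x <-> mpoc_phi_feasible g h G H phi_min x.
Proof.
have orE l : (G l x <= 0 \/ H l x <= 0) <-> phi_min (vec2 (G l x) (H l x)) <= 0.
  by rewrite phi_min_vec2 ge_min; split => /orP.
by split=> -[gx hx GHx]; split=> // l; apply/orE.
Qed.

(** Among the constraints with vanishing minimum, a multiplier of G_l (resp.
    H_l) is present exactly when G_l (resp. H_l) vanishes; this writes the three
    index sets of the stationarity conditions relative to a single one. *)
Lemma Iphi_minE (R : realType) n q (G H : 'I_q -> 'rV[R]_n -> R) x :
  [/\ I0p G H x :|: I00 G H x =
        Iphi G H phi_min x :&: [set l | G l x == 0]%SET,
      Ip0 G H x :|: I00 G H x =
        Iphi G H phi_min x :&: [set l | H l x == 0]%SET
    & I00 G H x = Iphi G H phi_min x :&: [set l | G l x == 0]%SET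
                    :&: [set l | H l x == 0]%SET].
Proof.
by split; apply/setP => l;
  rewrite !inE phi_min_vec2 [Order.min _ _ == 0]eq_le ge_min le_min;
  case: (ltgtP (G l x) 0) => _; case: (ltgtP (H l x) 0) => _.
Qed.

(** The common part of the two equivalences: P is the coupling imposed on a pair
    of multipliers of a biactive constraint, vacuous for W-stationarity and
    complementarity for M-stationarity. It has to hold on both axes because at
    a constraint which is not biactive one multiplier is absent, that is, zero. *)
Lemma multipliers_phi_minP (R : realType) n m p q (f : 'rV[R]_n -> R)
    (g : 'I_m -> 'rV[R]_n -> R) (h : 'I_p -> 'rV[R]_n -> R)
    (G H : 'I_q -> 'rV[R]_n -> R) (P : R -> R -> Prop)
    (S : ('rV[R]_2 -> R) -> 'rV[R]_2 -> set 'rV[R]_2) x :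
  (forall a, P a 0) -> (forall b, P 0 b) ->
  (forall v a b, subgrad_cone (S phi_min v) a b <->
     [/\ 0 <= a, 0 <= b, P a b, v ord0 ord0 != phi_min v -> a = 0
       & v ord0 ord_max != phi_min v -> b = 0]) ->
  mpoc_feasible g h G H x ->
  (exists lambda rho mu nu, W_multipliers f g h G H x lambda rho mu nu /\
     forall l, l \in I00 G H x -> P (mu l) (nu l)) <->
  KKT_point f g h G H S phi_min x.
Proof.
move=> Pa0 P0b coneE xfeas.
have [AE BE I00E] := Iphi_minE G H x.
have Iphi_eq0 l : l \in Iphi G H phi_min x ->
    phi_min (vec2 (G l x) (H l x)) = 0 by rewrite inE => /eqP.
have sumE (a b : 'I_q -> R) :
    (forall l, l \in Iphi G H phi_min x -> G l x != 0 -> a l = 0) ->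
    (forall l, l \in Iphi G H phi_min x -> H l x != 0 -> b l = 0) ->
    \sum_(l in Iphi G H phi_min x)
       (a l *: gradient (G l) x + b l *: gradient (H l) x)
    = \sum_(l in I0p G H x :|: I00 G H x) a l *: gradient (G l) x
      + \sum_(l in Ip0 G H x :|: I00 G H x) b l *: gradient (H l) x.
  move=> aG bH; rewrite AE BE big_split /=; congr (_ + _).
  - rewrite (big_setID [set l | G l x == 0]%SET) /= [X in _ + X]big1 ?addr0 //.
    by move=> l; rewrite finset.in_setD inE => /andP[Gl lI]; rewrite aG // scale0r.
  - rewrite (big_setID [set l | H l x == 0]%SET) /= [X in _ + X]big1 ?addr0 //.
    by move=> l; rewrite finset.in_setD inE => /andP[Hl lI]; rewrite bH // scale0r.
have scaleE (c a b : R) (u w : 'rV[R]_n) :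
    c *: (a *: u + b *: w) = (c * a) *: u + (c * b) *: w.
  by rewrite scalerDr 2!scalerA.
split.
- move=> [lambda [rho [mu [nu [[lam0 mu0 nu0 stat] Pmn]]]]].
  split; first exact/phi_min_feasible.
  (* The given multipliers are arbitrary outside their index sets, whereas the
     cone condition requires zero there. *)
  pose a l := if G l x == 0 then mu l else 0.
  pose b l := if H l x == 0 then nu l else 0.
  have cone l : exists t : R * R * R, l \in Iphi G H phi_min x ->
      [/\ 0 <= t.1.1, S phi_min (vec2 (G l x) (H l x)) (vec2 t.1.2 t.2),
          a l = t.1.1 * t.1.2 & b l = t.1.1 * t.2].
    have [lI|] := boolP (l \in Iphi G H phi_min x); last by exists (0, 0, 0).
    have : subgrad_cone (S phi_min (vec2 (G l x) (H l x))) (a l) (b l).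
      apply/coneE; rewrite Iphi_eq0 // vec2_0 vec2_1 /a /b.
      have muG : G l x == 0 -> 0 <= mu l.
        by move=> Gl; apply: mu0; rewrite AE finset.in_setI lI inE.
      have nuH : H l x == 0 -> 0 <= nu l.
        by move=> Hl; apply: nu0; rewrite BE finset.in_setI lI inE.
      split.
      + by case: ifP.
      + by case: ifP.
      + case: ifP => // Gl; case: ifP => // Hl.
        by apply: Pmn; rewrite I00E !finset.in_setI lI !inE Gl.
      + by move=> /negbTE ->.
      + by move=> /negbTE ->.
    by move=> [xi [al [be h4]]]; exists (xi, al, be).
  have [t tP] := choice cone.
  exists lambda, rho, (fun l => (t l).1.1), (fun l => (t l).1.2),
    (fun l => (t l).2); split => //.
  + by move=> l /tP[].
  + by move=> l /tP[].
  apply: (etrans stat); rewrite -addrA; congr (_ + _).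
  transitivity (\sum_(l in Iphi G H phi_min x)
      (a l *: gradient (G l) x + b l *: gradient (H l) x)); last first.
    by apply: eq_bigr => l /tP[_ _ -> ->]; rewrite scaleE.
  rewrite sumE; first congr (_ + _).
  + by apply: eq_bigr => l; rewrite AE finset.in_setI !inE /a => /andP[_ ->].
  + by apply: eq_bigr => l; rewrite BE finset.in_setI !inE /b => /andP[_ ->].
  + by move=> l _ /negbTE Gl; rewrite /a Gl.
  + by move=> l _ /negbTE Hl; rewrite /b Hl.
- move=> [_ [lambda [rho [xi [al [be [lam0 xi0 sub stat]]]]]]].
  have cone l : l \in Iphi G H phi_min x ->
      [/\ 0 <= xi l * al l, 0 <= xi l * be l, P (xi l * al l) (xi l * be l),
          G l x != 0 -> xi l * al l = 0 & H l x != 0 -> xi l * be l = 0].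
    move=> lI; have : subgrad_cone (S phi_min (vec2 (G l x) (H l x)))
        (xi l * al l) (xi l * be l).
      by exists (xi l), (al l), (be l); split; [exact: xi0|exact: sub|..].
    by move=> /coneE; rewrite Iphi_eq0 // vec2_0 vec2_1.
  exists lambda, rho, (fun l => xi l * al l), (fun l => xi l * be l).
  split; last by move=> l; rewrite I00E !finset.in_setI => /andP[/andP[/cone[]]].
  split => //.
  + by move=> l; rewrite AE finset.in_setI => /andP[/cone[]].
  + by move=> l; rewrite BE finset.in_setI => /andP[/cone[]].
  apply: (etrans stat); rewrite -[RHS]addrA; congr (_ + _).
  rewrite -sumE; last 2 first.
  + by move=> l /cone[].
  + by move=> l /cone[].
  by apply: eq_bigr => l _; rewrite scaleE.
Qed.

(** * The equivalences *)

Theorem proposition3p4 (R : realType) (n m p q : nat)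
    (n_gt0 : (0 < n)%N) (m_gt0 : (0 < m)%N) (p_gt0 : (0 < p)%N)
    (q_gt0 : (0 < q)%N)
    (f : 'rV[R]_n -> R) (g : 'I_m -> 'rV[R]_n -> R)
    (h : 'I_p -> 'rV[R]_n -> R) (G H : 'I_q -> 'rV[R]_n -> R)
    (f_C1 : continuously_differentiable f)
    (g_C1 : forall i, continuously_differentiable (g i))
    (h_C1 : forall j, continuously_differentiable (h j))
    (G_C1 : forall l, continuously_differentiable (G l))
    (H_C1 : forall l, continuously_differentiable (H l)) :
  (forall x : 'rV[R]_n, mpoc_feasible g h G H x ->
     W_stationary f g h G H x <->
     KKT_point f g h G H clarke_subdiff phi_min x)
  /\
  (forall x : 'rV[R]_n, mpoc_feasible g h G H x ->
     M_stationary f g h G H x <->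
     KKT_point f g h G H mordukhovich_subdiff phi_min x).
Proof.
split=> x xfeas.
- rewrite -(@multipliers_phi_minP _ _ _ _ _ f g h G H (fun _ _ => True)) //.
    split=> [[_ [la [rho [mu [nu Wm]]]]]|[la [rho [mu [nu [Wm _]]]]]].
      by exists la, rho, mu, nu.
    by split => //; exists la, rho, mu, nu.
  move=> v a b; rewrite clarke_cone_phi_min.
  by split=> [[]|[]].
- rewrite -(@multipliers_phi_minP _ _ _ _ _ f g h G H (fun a b => a * b = 0)) //.
  + by split=> [[]|].
  + exact: mulr0.
  + exact: mul0r.
  + exact: mordukhovich_cone_phi_min.
Qed.
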